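(* Let $k\ge 2$ be an integer. For every integer $n$ and every integer $r\ge 1$, $$\left(F^{(k)}_{n}\right)^2-F^{(k)}_{n-r}F^{(k)}_{n+r}=F^{(k)}_{n-1,\,n}+F^{(k)}_{n-2,\,n+1}+\cdots+F^{(k)}_{n-r,\,n+r-1},$$ i.e. the right-hand side is $\sum_{j=1}^{r}F^{(k)}_{n-j,\,n+j-1}$.
   Context: The $k$-bonacci numbers $(F^{(k)}_n)_{n\in\mathbb{Z}}$ are the bi-infinite integer sequence with $F^{(k)}_0=\cdots=F^{(k)}_{k-2}=0$, $F^{(k)}_{k-1}=1$ and $F^{(k)}_n=\sum_{i=1}^k F^{(k)}_{n-i}$ for all $n\in\mathbb{Z}$ (for $k=2$ these are the Fibonacci numbers). Let $\phi_1,\dots,\phi_k\in\mathbb{C}$ be the roots of $x^k-x^{k-1}-\cdots-x-1$; they are distinct and nonzero. For integers $t_1,\dots,t_k$ let $\|t_1,\dots,t_k\|=\det(\phi_i^{t_j})_{1\le i,j\le k}$. The single-index numbers satisfy the Binet formula $F^{(k)}_n=\|0,1,\dots,k-2,n\|/\|0,1,\dots,k-1\|$. The two-index numbers are defined, for $m,n\in\mathbb{Z}$, by $$F^{(k)}_{m,n}=\frac{\|0,1,\dots,k-3,m,n\|}{\|0,1,\dots,k-1\|}$$ (for $k=2$ the numerator is $\|m,n\|$). *)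

(* Defs.v *)
From mathcomp Require Import all_boot all_order all_algebra.
From mathcomp Require Import reals.
From mathcomp Require Import complex.

Set Implicit Arguments.
Unset Strict Implicit.
Unset Printing Implicit Defensive.

Import Order.TTheory GRing.Theory Num.Theory.

Local Open Scope ring_scope.

(* The k-bonacci numbers are generated by sliding the window
   [:: F_n; ...; F_(n+k-1)] by one step, in either direction. *)
Definition kb_init (k : nat) : seq int := rcons (nseq k.-1 0) 1.

Definition kb_next (s : seq int) : seq int :=
  rcons (behead s) (\sum_(x <- s) x).

(* F_(n-1) = F_(n+k-1) - (F_n + ... + F_(n+k-2)) *)
Definition kb_prev (s : seq int) : seq int :=
  let s' := take (size s).-1 s in (last 0 s - \sum_(x <- s') x) :: s'.

Definition kb_window (k : nat) (n : int) : seq int :=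
  match n with
  | Posz m => iter m kb_next (kb_init k)
  | Negz m => iter m.+1 kb_prev (kb_init k)
  end.

Definition kbonacci (k : nat) (n : int) : int := head 0 (kb_window k n).

Lemma size_kb_window k n : (0 < k)%N -> size (kb_window k n) = k.
Proof.
move=> k0.
have Hi : size (kb_init k) = k by rewrite size_rcons size_nseq prednK.
case: n => m; rewrite /kb_window; move: (m) => {}m.
  elim: m => [//|m IH].
  by rewrite iterS /kb_next size_rcons size_behead IH prednK.
elim: m.+1 => [//|{}m IH].
by rewrite iterS /kb_prev /= size_take IH prednK // leqnn prednK.
Qed.

Lemma kb_prevK s : (0 < size s)%N -> kb_next (kb_prev s) = s.
Proof.
case/lastP: s => // s x _.
rewrite /kb_prev size_rcons last_rcons /= -cats1 take_size_cat //.
by rewrite /kb_next /= big_cons subrK cats1.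
Qed.

Lemma kb_windowS k n : (0 < k)%N -> kb_window k (n + 1) = kb_next (kb_window k n).
Proof.
move=> k0; case: n => m.
  by rewrite -PoszD addn1.
have -> : Negz m + 1 = - m%:Z by rewrite NegzE -addn1 PoszD opprD addrK.
have E : kb_window k (- m%:Z) = iter m kb_prev (kb_init k) by case: m.
rewrite [in RHS]/kb_window iterS kb_prevK // -E.
by rewrite size_kb_window.
Qed.

Lemma nth_kb_window k n i : (0 < k)%N -> (i < k)%N ->
  nth 0 (kb_window k n) i = kbonacci k (n + i%:Z).
Proof.
move=> k0; elim: i n => [|i IH] n ik; first by rewrite addr0 /kbonacci nth0.
have -> : n + i.+1%:Z = (n + 1) + i%:Z by rewrite -addn1 PoszD addrAC addrA.
rewrite -IH; last exact: ltnW.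
rewrite kb_windowS // /kb_next nth_rcons size_behead size_kb_window //.
have -> : (i < k.-1)%N by rewrite -ltnS prednK.
by rewrite nth_behead.
Qed.

Lemma kbonacci_init0 k (i : nat) : (i < k.-1)%N -> kbonacci k i%:Z = 0.
Proof.
move=> ik; have k0 : (0 < k)%N by case: k ik.
rewrite -[X in kbonacci k X]add0r -nth_kb_window //; last first.
  exact: leq_trans ik (leq_pred _).
by rewrite /= /kb_init nth_rcons size_nseq ik nth_nseq ik.
Qed.

Lemma kbonacci_init1 k : (0 < k)%N -> kbonacci k k.-1%:Z = 1.
Proof.
move=> k0; rewrite -[X in kbonacci k X]add0r -nth_kb_window ?prednK //.
by rewrite /= /kb_init nth_rcons size_nseq ltnn eqxx.
Qed.

Lemma kbonacci_rec k (n : int) : (0 < k)%N ->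
  kbonacci k n = \sum_(1 <= i < k.+1) kbonacci k (n - i%:Z).
Proof.
move=> k0.
have -> : kbonacci k n = nth 0 (kb_window k (n - k%:Z + 1)) k.-1.
  rewrite nth_kb_window ?prednK //; congr (kbonacci k _).
  by rewrite -addrA -PoszD add1n prednK // subrK.
rewrite kb_windowS // /kb_next nth_rcons size_behead size_kb_window //.
rewrite ltnn eqxx (big_nth 0) size_kb_window // big_nat_rev /= add0n.
rewrite big_add1 /= [LHS]big_nat [RHS]big_nat; apply: eq_bigr => i ik.
rewrite nth_kb_window //; last by rewrite ltn_subrL k0.
by congr (kbonacci k _); rewrite -subzn // addrA subrK.
Qed.

Definition kbonacci_poly (A : nzRingType) (k : nat) : {poly A} :=
  'X^k - \sum_(i < k) 'X^i.

(* phi lists the roots of the k-bonacci polynomial, with multiplicity. *)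
Definition kbonacci_roots (A : fieldType) (k : nat) (phi : 'I_k -> A) : Prop :=
  kbonacci_poly A k = \prod_(i < k) ('X - (phi i)%:P).

Lemma kbonacci_roots_exist (A : closedFieldType) (k : nat) :
  exists phi : 'I_k -> A, kbonacci_roots phi.
Proof.
have Hs : (size (\sum_(i < k) ('X^i : {poly A}))%R <= k)%N.
  apply: (leq_trans (size_sum _ _ _)); apply/bigmax_leqP => i _.
  by rewrite size_polyXn.
have Hp : (size (- (\sum_(i < k) ('X^i : {poly A}))%R) < size ('X^k : {poly A}))%N.
  by rewrite size_polyN size_polyXn.
have [s Es] := closed_field_poly_normal (kbonacci_poly A k).
have L1 : lead_coef (kbonacci_poly A k) = 1.
  by rewrite /kbonacci_poly lead_coefDl // lead_coefXn.
rewrite L1 scale1r in Es.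
have sk : size s = k.
  have := congr1 (fun p : {poly A} => size p) Es.
  by rewrite /kbonacci_poly size_polyDl // size_polyXn size_prod_XsubC => -[].
exists (fun i => nth 0 s i); rewrite /kbonacci_roots Es.
by rewrite (big_nth 0) sk big_mkord.
Qed.

Definition gen_vandermonde (A : fieldType) (k : nat) (phi : 'I_k -> A)
    (t : nat -> int) : A :=
  \det (\matrix_(i < k, j < k) (phi i ^ t j)).

(* The exponents 0, 1, ..., k-3, m, n, in positions 0, ..., k-1. *)
Definition exponents2 (k : nat) (m n : int) (j : nat) : int :=
  if (j < k - 2)%N then j%:Z else if j == (k - 2)%N then m else n.

Definition kbonacci2 (A : fieldType) (k : nat) (phi : 'I_k -> A)
    (m n : int) : A :=
  gen_vandermonde phi (exponents2 k m n) / gen_vandermonde phi Posz.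

(* Main.v *)
Require Import Defs.
From mathcomp Require Import all_boot all_order all_algebra.
From mathcomp Require Import reals.
From mathcomp Require Import complex.
From mathcomp Require Import perm ring zify.

Set Implicit Arguments.
Unset Strict Implicit.
Unset Printing Implicit Defensive.

Import Order.TTheory GRing.Theory Num.Theory.

Local Open Scope ring_scope.

(** The identity telescopes once the two-index numbers are written through the
    one-index ones:
      F_(m,n) = F_(m+1) F_n - F_(n+1) F_m          (lemma [kbonacci2E]).
    Indeed the term of index j of the sum then is
      F_(n-j+1) F_(n+j-1) - F_(n+j) F_(n-j) = P_(j-1) - P_j,
    with P_j = F_(n-j) F_(n+j), and the sum is P_0 - P_r.

    The formula for F_(m,n) comes from the linear recurrence.  A column
    (phi_i ^ n)_i satisfies the k-bonacci recurrence in n, and a determinant is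
    linear in each column, so D(m,n) = ||0,...,k-3,m,n|| satisfies the
    recurrence in m and in n ([kb_recurrent_gen_vandermonde]).  A bi-infinite
    solution of the recurrence is determined by its values at 0, ..., k-1
    ([kb_recurrent_ext]).  Hence it suffices to compare D(m,n) with
    V (F_(m+1) F_n - F_(n+1) F_m), where V = ||0,...,k-1||, for m and n in this
    range, where the columns 0, ..., k-3 make D vanish by alternation and only
    D(k-2,k-1) = V = - D(k-1,k-2) is left ([exponents2E]).

    Dividing by V requires V <> 0, that is, distinct roots.  Multiplying the
    k-bonacci polynomial by X - 1 gives X^(k+1) - 2 X^k + 1, whose derivative
    is X^(k-1) ((k+1) X - 2k).  A double root a thus is 2k/(k+1), and
    a^k (2 - a) = 1 becomes the equation 2 (2k)^k = (k+1)^(k+1) between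
    integers; it makes k divide a power of k+1, which is coprime to k, so k = 1
    ([kbonacci_roots_inj]). *)

(** * Bi-infinite sequences satisfying the k-bonacci recurrence *)

Definition kb_recurrent {A : zmodType} (k : nat) (s : int -> A) : Prop :=
  forall n, s (n + k%:Z) = \sum_(i < k) s (n + i%:Z).

Lemma kb_recurrentB (A : zmodType) (k : nat) (s t : int -> A) :
  kb_recurrent k s -> kb_recurrent k t ->
  kb_recurrent k (fun n => s n - t n).
Proof. by move=> Hs Ht n; rewrite Hs Ht -sumrB. Qed.

Lemma kb_recurrentZ (A : nzRingType) (k : nat) (c : A) (s : int -> A) :
  kb_recurrent k s -> kb_recurrent k (fun n => c * s n).
Proof. by move=> Hs n; rewrite Hs mulr_sumr. Qed.

Lemma kb_recurrent_shift (A : zmodType) (k : nat) (s : int -> A) :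
  kb_recurrent k s -> kb_recurrent k (fun n => s (n + 1)).
Proof.
by move=> Hs n; rewrite addrAC Hs; apply: eq_bigr => i _; rewrite addrAC.
Qed.

(** The vanishing of k consecutive terms propagates in both directions: upwards
    by the recurrence, and downwards because the earliest of the k summands is
    the latest term minus the other ones. *)
Lemma kb_recurrent_eq0 (A : zmodType) (k : nat) (s : int -> A) :
  (0 < k)%N -> kb_recurrent k s ->
  (forall i : nat, (i < k)%N -> s i = 0) -> forall n, s n = 0.
Proof.
move=> k0 Hs s0 n.
suff W (i : nat) : (i < k)%N -> s (n + i%:Z) = 0 by rewrite -[n]addr0 W.
elim/int_ind: n i => [|n IH|n IH] i ik; first by rewrite add0r s0.
- have -> : n.+1%:Z + i%:Z = n%:Z + i.+1%:Z by lia.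
  have [/IH //|] := ltnP i.+1 k.
  rewrite leq_eqVlt ltnNge ik orbF => /eqP <-.
  by rewrite Hs big1 // => j _; apply: IH.
- case: i ik => [_|i ik]; last first.
    have -> : - n.+1%:Z + i.+1%:Z = - n%:Z + i%:Z by lia.
    by apply: IH; apply: ltnW.
  move: (Hs (- n.+1%:Z)); case: k k0 {Hs s0} IH => // k _ IH.
  have -> : - n.+1%:Z + k.+1%:Z = - n%:Z + k%:Z by lia.
  rewrite IH // big_ord_recl big1 ?addr0 // => j _.
  rewrite lift0; have -> : - n.+1%:Z + j.+1%:Z = - n%:Z + j%:Z by lia.
  by apply: IH; apply: ltnW; apply: (ltn_ord j).
Qed.

Lemma kb_recurrent_ext (A : zmodType) (k : nat) (s t : int -> A) :
  (0 < k)%N -> kb_recurrent k s -> kb_recurrent k t ->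
  (forall i : nat, (i < k)%N -> s i = t i) -> s =1 t.
Proof.
move=> k0 Hs Ht st n; apply/eqP; rewrite -subr_eq0; apply/eqP.
apply: (kb_recurrent_eq0 k0 (kb_recurrentB Hs Ht)) => i ik.
by rewrite st // subrr.
Qed.

Lemma kb_recurrent_kbonacci (A : nzRingType) (k : nat) : (0 < k)%N ->
  kb_recurrent k (fun n => (kbonacci k n)%:~R : A).
Proof.
move=> k0 n; rewrite kbonacci_rec // rmorph_sum /= big_add1 /=.
rewrite -(big_mkord xpredT (fun i => (kbonacci k (n + i%:Z))%:~R : A)).
rewrite big_nat_rev /= [LHS]big_nat [RHS]big_nat.
by apply: eq_bigr => i ik; congr (kbonacci k _)%:~R; lia.
Qed.

Lemma kbonacci_succ_init (k : nat) : (2 <= k)%N -> kbonacci k k%:Z = 1.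
Proof.
case: k => [|[|k]] // _.
have := @kb_recurrent_kbonacci int k.+2 isT 0.
rewrite !add0r intz => ->; rewrite big_ord_recr big1 /= => [|i _].
  by rewrite add0r intz add0r (kbonacci_init1 (k := k.+2)).
by rewrite add0r intz kbonacci_init0 //=; apply: (ltn_ord i).
Qed.

(** * Generalized Vandermonde determinants at the roots *)

Section Roots.
Variables (A : fieldType) (k : nat) (phi : 'I_k -> A).
Hypothesis (phi_roots : kbonacci_roots phi).

Lemma kbonacci_root_eq i : phi i ^+ k = \sum_(j < k) phi i ^+ j.
Proof.
have : (kbonacci_poly A k).[phi i] = 0.
  by rewrite phi_roots horner_prod (bigD1 i) //= !hornerE subrr mul0r.
rewrite /kbonacci_poly hornerD hornerN hornerXn horner_sum => /eqP.
rewrite subr_eq0 => /eqP ->.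
by apply: eq_bigr => j _; rewrite hornerXn.
Qed.

Lemma kbonacci_root_neq0 i : phi i != 0.
Proof.
apply/eqP => p0; have := kbonacci_root_eq i; rewrite p0.
case: k i {p0} => [[]//|n] _.
rewrite expr0n /= big_ord_recl expr0 big1 ?addr0 => [/eqP|j _].
  by rewrite eq_sym oner_eq0.
by rewrite expr0n.
Qed.

Lemma kb_recurrent_root i : kb_recurrent k (fun n => phi i ^ n).
Proof.
move=> n; have nz := kbonacci_root_neq0 i.
rewrite expfzDr // -exprnP kbonacci_root_eq mulr_sumr.
by apply: eq_bigr => j _; rewrite expfzDr.
Qed.

(** Expanding along column [a], the only one that depends on [n], exhibits the
    determinant as a fixed linear combination of the powers phi_i ^ n. *)
Lemma kb_recurrent_gen_vandermonde (t : int -> nat -> int) (a : 'I_k) :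
  (forall n, t n a = n) ->
  (forall m n (j : 'I_k), j != a -> t m j = t n j) ->
  kb_recurrent k (fun n => gen_vandermonde phi (t n)).
Proof.
move=> ta tj.
pose M n := \matrix_(i < k, j < k) (phi i ^ t n j).
have E n : gen_vandermonde phi (t n) = \sum_i cofactor (M 0) i a * phi i ^ n.
  rewrite /gen_vandermonde -/(M n) (expand_det_col _ a).
  apply: eq_bigr => i _; rewrite mxE ta mulrC; congr (_ * _).
  rewrite /cofactor; congr (_ * \det _); apply/matrixP => u v.
  by rewrite !mxE (tj n 0) // eq_sym neq_lift.
move=> n; rewrite E [RHS](eq_bigr _ (fun j _ => E _)) exchange_big.
apply: eq_bigr => i _.
exact: (kb_recurrentZ _ (kb_recurrent_root i)).
Qed.

Lemma gen_vandermonde_alternate (t : nat -> int) (a b : 'I_k) :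
  a != b -> t a = t b -> gen_vandermonde phi t = 0.
Proof.
move=> ab tab; rewrite /gen_vandermonde -det_tr.
by apply: (determinant_alternate ab) => i; rewrite !mxE tab.
Qed.

Lemma gen_vandermonde_swap (t u : nat -> int) (a b : 'I_k) :
  a != b -> t a = u b -> t b = u a ->
  (forall j : 'I_k, j != a -> j != b -> t j = u j) ->
  gen_vandermonde phi t = - gen_vandermonde phi u.
Proof.
move=> ab tab tba tu; rewrite /gen_vandermonde.
set M := \matrix_(i, j) _; set N := \matrix_(i, j) _.
have -> : M = xcol a b N.
  apply/matrixP => i j; rewrite !mxE.
  by case: tpermP => [->|->|/eqP ja /eqP jb]; rewrite ?tab ?tba ?tu.
by rewrite xcolE det_mulmx det_perm odd_tperm ab expr1 mulrN1.
Qed.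

Lemma gen_vandermondeE :
  gen_vandermonde phi Posz = \prod_(i < k) \prod_(j < k | (i < j)%N) (phi j - phi i).
Proof.
have -> : gen_vandermonde phi Posz = \det (Vandermonde k (\row_i phi i)).
  rewrite /gen_vandermonde -det_tr; congr (\det _).
  by apply/matrixP => i j; rewrite !mxE.
rewrite det_Vandermonde; apply: eq_bigr => i _; apply: eq_bigr => j _.
by rewrite !mxE.
Qed.

End Roots.

(** * The roots are distinct *)

Lemma mul_kbonacci_poly (A : nzRingType) (k : nat) :
  ('X - 1) * kbonacci_poly A k = 'X^(k.+1) - ('X^k) *+ 2 + 1.
Proof.
by rewrite /kbonacci_poly mulrBr -subrX1 mulrBl mul1r -exprS mulr2n !opprD opprK !addrA.
Qed.

(** A double root would be 2k/(k+1), which divisibility by k rules out. *)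
Lemma kbonacci_roots_inj (A : numFieldType) (k : nat) (phi : 'I_k -> A) :
  (2 <= k)%N -> kbonacci_roots phi -> injective phi.
Proof.
move=> k2 phi_roots i j aE; apply/eqP/negPn/negP => ij.
set a := phi i in aE.
have a0 : a != 0 := kbonacci_root_neq0 phi_roots i.
have [q Eq] : exists q, 'X^(k.+1) - ('X^k) *+ 2 + 1 = ('X - a%:P) * (('X - a%:P) * q).
  exists (('X - 1) * \prod_(l < k | (l != i) && (l != j)) ('X - (phi l)%:P)).
  rewrite -mul_kbonacci_poly phi_roots (bigD1 i) //= (bigD1 j) /=; last by rewrite eq_sym.
  by rewrite -aE; ring.
(* the value at the double root *)
have e0 : a ^+ k * (2 - a) = 1.
  have := congr1 (horner^~ a) Eq.
  rewrite /= hornerM hornerXsubC subrr mul0r !hornerE exprS => e.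
  by apply/eqP; rewrite -subr_eq0 -oppr_eq0 -e; apply/eqP; ring.
(* the value of the derivative at the double root, divided by a^(k-1) *)
have e1 : k.+1%:R * a = k.*2%:R.
  have := congr1 (fun p : {poly A} => p^`().[a]) Eq.
  rewrite /= derivM derivD derivB derivMn !derivXn derivC derivXsubC mul1r addr0.
  rewrite [in RHS]hornerD !hornerM hornerXsubC subrr !mul0r addr0.
  rewrite !hornerE !hornerMn !hornerXn /= -[in a ^+ k](prednK (ltnW k2)) exprS => e.
  apply: (mulfI (expf_neq0 k.-1 a0)); apply/eqP; rewrite -subr_eq0 -[X in _ == X]e.
  by apply/eqP; rewrite -muln2 natrM -(mulr_natr (a * _)) -(mulr_natr (a ^+ _) k); ring.
(* multiply a^k (2 - a) = 1 by (k+1)^(k+1) and substitute (k+1) a = 2k *)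
have E : (k.*2 ^ k * 2 = k.+1 ^ k.+1)%N.
  apply/eqP; rewrite -(eqr_nat A) natrM !natrX -e1 exprMn exprS.
  have -> : k.+1%:R * k.+1%:R ^+ k = k.+1%:R * k.+1%:R ^+ k * (a ^+ k * (2 - a)) :> A.
    by rewrite e0 mulr1.
  have -> : k.+1%:R * k.+1%:R ^+ k * (a ^+ k * (2 - a))
    = (k.+1%:R * 2 - k.+1%:R * a) * (k.+1%:R ^+ k * a ^+ k) by ring.
  by rewrite e1 -muln2 natrM -addn1 natrD; apply/eqP; ring.
have : (k %| k.+1 ^ k.+1)%N.
  by rewrite -E dvdn_mulr // dvdn_exp ?(ltnW k2) // -muln2 dvdn_mulr.
rewrite -[(_ ^ _)%N]muln1 Gauss_dvdr ?dvdn1 ?gtn_eqF //.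
by rewrite coprimeXr // coprimenS.
Qed.

Lemma gen_vandermonde_neq0 (A : numFieldType) (k : nat) (phi : 'I_k -> A) :
  (2 <= k)%N -> kbonacci_roots phi -> gen_vandermonde phi Posz != 0.
Proof.
move=> k2 phi_roots; rewrite gen_vandermondeE.
apply/prodf_neq0 => i _; apply/prodf_neq0 => j ij; rewrite subr_eq0.
by apply: contraTneq ij => /(kbonacci_roots_inj k2 phi_roots) ->; rewrite ltnn.
Qed.

(** * Two-index numbers in terms of one-index numbers *)

Section TwoIndex.
Variables (A : fieldType) (k : nat) (phi : 'I_k -> A).
Hypotheses (k2 : (2 <= k)%N) (phi_roots : kbonacci_roots phi).

Let F (n : int) : A := (kbonacci k n)%:~R.
Let V : A := gen_vandermonde phi Posz.
Let D (m n : int) : A := gen_vandermonde phi (exponents2 k m n).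

Lemma penult_lt : (k - 2 < k)%N. Proof. lia. Qed.
Lemma last_lt : (k - 1 < k)%N. Proof. lia. Qed.
Let a := Ordinal penult_lt.
Let b := Ordinal last_lt.

Lemma exponents2_penult m n : exponents2 k m n a = m.
Proof. by rewrite /exponents2 ltnn eqxx. Qed.

Lemma exponents2_last m n : exponents2 k m n b = n.
Proof. by rewrite /exponents2 ifN 1?ifN //=; lia. Qed.

Lemma kb_recurrent_exponents2l n : kb_recurrent k (D^~ n).
Proof.
apply: (@kb_recurrent_gen_vandermonde _ _ _ phi_roots _ a) => [m|m m' j ja].
  exact: exponents2_penult.
by rewrite /exponents2 [_ == (k - 2)%N](negbTE ja).
Qed.

Lemma exponents2_swap m n : D m n = - D n m.
Proof.
apply: (@gen_vandermonde_swap _ _ _ _ _ a b).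
- by rewrite -val_eqE /=; lia.
- by rewrite exponents2_penult exponents2_last.
- by rewrite exponents2_penult exponents2_last.
move=> j ja jb; rewrite /exponents2; case: ifP => // jk.
by move: ja jb (ltn_ord j); rewrite -!val_eqE /=; lia.
Qed.

Lemma exponents2_diag m : D m m = 0.
Proof.
apply: (@gen_vandermonde_alternate _ _ _ _ a b).
  by rewrite -val_eqE /=; lia.
by rewrite exponents2_penult exponents2_last.
Qed.

Lemma exponents2_small (i : nat) n : (i < k - 2)%N -> D i n = 0.
Proof.
move=> ik; have ik' : (i < k)%N by lia.
apply: (@gen_vandermonde_alternate _ _ _ _ (Ordinal ik') a).
  by rewrite -val_eqE /=; lia.
by rewrite exponents2_penult /exponents2 /= ik.
Qed.

Lemma exponents2_id : D (k - 2)%N (k - 1)%N = V.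
Proof.
congr (\det _); apply/matrixP => i j; rewrite !mxE /exponents2.
by congr (_ ^ _); move: (ltn_ord j); do 2?case: ifP; lia.
Qed.

Lemma F_small (i : nat) : (i < k - 1)%N -> F i = 0.
Proof. by move=> ik; rewrite /F kbonacci_init0 // -subn1. Qed.

Lemma F_pred : F (k - 1)%N = 1.
Proof. by rewrite /F subn1 kbonacci_init1 // ltnW. Qed.

Lemma F_k : F k = 1.
Proof. by rewrite /F kbonacci_succ_init. Qed.

(** Both sides satisfy the recurrence in [m], so only [m < k] matters.  There the
    left side is a recurrent function of [n], up to the sign of the swap, and is
    in turn determined by its values for [n < k]. *)
Lemma exponents2E m n : D m n = V * (F (m + 1) * F n - F (n + 1) * F m).
Proof.
have k0 : (0 < k)%N by lia.
have FR : kb_recurrent k F by exact: kb_recurrent_kbonacci.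
have GR : kb_recurrent k (fun x => V * (F n * F (x + 1) - F (n + 1) * F x)).
  apply: kb_recurrentZ; apply: kb_recurrentB; apply: kb_recurrentZ => //.
  exact: kb_recurrent_shift.
have S1 (i : nat) : F (i%:Z + 1) = F i.+1 by rewrite -addn1 PoszD.
(* D(x, k-2) and - V F_x agree for x < k: both vanish except at x = k-1 *)
have Ea n' : D n' (k - 2)%N = - (V * F n').
  have := @kb_recurrent_ext _ k (D^~ (k - 2)%N) (fun x => - V * F x) k0
    (kb_recurrent_exponents2l _) (kb_recurrentZ _ FR).
  move=> /= ->; [by rewrite mulNr|move=> i ik].
  have [i2|] := ltnP i (k - 2).
    by rewrite exponents2_small // F_small ?mulr0 //; lia.
  rewrite leq_eqVlt => /orP[/eqP <-|i2].
    by rewrite exponents2_diag F_small ?mulr0 //; lia.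
  have -> : i = (k - 1)%N by lia.
  by rewrite F_pred mulr1 exponents2_swap exponents2_id.
(* F_(x+1) - F_x is the solution with value 1 at k-2 and 0 elsewhere below k *)
have Eb n' : D n' (k - 1)%N = V * (F (n' + 1) - F n').
  have := @kb_recurrent_ext _ k (D^~ (k - 1)%N) (fun x => V * (F (x + 1) - F x)) k0
    (kb_recurrent_exponents2l _)
    (kb_recurrentZ _ (kb_recurrentB (kb_recurrent_shift FR) FR)).
  rewrite /= => -> // i ik; rewrite S1.
  have [i2|] := ltnP i (k - 2).
    by rewrite exponents2_small // !F_small ?subr0 ?mulr0 //; lia.
  rewrite leq_eqVlt => /orP[/eqP <-|i2].
    have -> : (k - 2).+1 = (k - 1)%N by lia.
    by rewrite exponents2_id F_pred F_small ?subr0 ?mulr1 //; lia.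
  have -> : i = (k - 1)%N by lia.
  have -> : (k - 1).+1 = k by lia.
  by rewrite exponents2_diag F_k F_pred subrr mulr0.
have := @kb_recurrent_ext _ k (D^~ n)
  (fun x => V * (F n * F (x + 1) - F (n + 1) * F x)) k0
  (kb_recurrent_exponents2l _) GR.
move=> /= ->; [by rewrite [F n * _]mulrC|move=> i ik].
rewrite S1.
have [i2|] := ltnP i (k - 2).
  rewrite exponents2_small // [F i]F_small; last by lia.
  by rewrite [F i.+1]F_small ?mulr0 ?subr0 ?mulr0 //; lia.
rewrite leq_eqVlt => /orP[/eqP <-|i2].
  have -> : (k - 2).+1 = (k - 1)%N by lia.
  by rewrite exponents2_swap Ea F_pred F_small; [ring|lia].
have -> : i = (k - 1)%N by lia.
have -> : (k - 1).+1 = k by lia.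
by rewrite exponents2_swap Eb F_k F_pred; ring.
Qed.

Lemma kbonacci2E m n : gen_vandermonde phi Posz != 0 ->
  kbonacci2 phi m n = (kbonacci k (m + 1) * kbonacci k n
    - kbonacci k (n + 1) * kbonacci k m)%:~R.
Proof.
move=> V0; rewrite /kbonacci2 -/(D m n) exponents2E -/V mulrAC divff // mul1r.
by rewrite rmorphB !rmorphM.
Qed.

End TwoIndex.

Theorem corollary4p5 (R : realType) (k : nat) (k_ge2 : (2 <= k)%N)
    (phi : 'I_k -> R[i]) (phi_roots : kbonacci_roots phi)
    (n : int) (r : nat) (r_ge1 : (1 <= r)%N) :
  (kbonacci k n)%:~R ^+ 2
    - (kbonacci k (n - r%:Z))%:~R * (kbonacci k (n + r%:Z))%:~R
  = \sum_(1 <= j < r.+1) kbonacci2 phi (n - j%:Z) (n + j%:Z - 1) :> R[i].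
Proof.
have V0 := gen_vandermonde_neq0 k_ge2 phi_roots.
pose P j : R[i] := (kbonacci k (n - j%:Z) * kbonacci k (n + j%:Z))%:~R.
have -> : \sum_(1 <= j < r.+1) kbonacci2 phi (n - j%:Z) (n + j%:Z - 1)
    = \sum_(0 <= j < r) (- P j.+1 - - P j).
  rewrite big_add1; apply: eq_bigr => j _; rewrite kbonacci2E //.
  have -> : n - j.+1%:Z + 1 = n - j%:Z by lia.
  have -> : n + j.+1%:Z - 1 + 1 = n + j.+1%:Z by lia.
  have -> : n + j.+1%:Z - 1 = n + j%:Z by lia.
  by rewrite rmorphB /= opprK addrC [kbonacci k (n + _) * _]mulrC.
rewrite telescope_sumr // opprK addrC /P.
by rewrite subr0 !rmorphM /= expr2.
Qed.
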